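(* Let $G_1$, $G_2$ be groups and let $H\le G_1\times G_2$ be a subgroup. For any integer $n\ge 1$ there exist $n$-connected commutative differential graded algebras $M_1$ and $M_2$ and a morphism $\varphi\colon M_1\to M_2$ of commutative differential graded algebras such that $\operatorname{Aut}_{\mathrm{CDGA}}(\varphi)\cong H$ and $\operatorname{Aut}_{\mathrm{CDGA}}(M_i)\cong G_i$ for $i=1,2$.
   Context: $\mathrm{CDGA}$ is the category of (unital, non-negatively graded) commutative differential graded algebras over $\mathbb{Q}$, with differential of degree $+1$, and unital algebra morphisms preserving degree and commuting with differentials. An algebra $A$ is called $n$-connected if $A^0=\mathbb{Q}$ and $A^i=0$ for $1\le i\le n$. Groups are arbitrary (possibly infinite), and the algebras are not required to be of finite type. For a morphism $\varphi\colon M_1\to M_2$, $\operatorname{Aut}_{\mathrm{CDGA}}(\varphi)$ is the group of pairs $(a,b)\in\operatorname{Aut}_{\mathrm{CDGA}}(M_1)\times\operatorname{Aut}_{\mathrm{CDGA}}(M_2)$ with $b\circ\varphi=\varphi\circ a$. *)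

(* Defs.v *)
From HB Require Import structures.
From mathcomp Require Import all_boot all_order all_algebra.
From mathcomp Require Import boolp classical_sets.

Set Implicit Arguments.
Unset Strict Implicit.
Unset Printing Implicit Defensive.

Import GRing.Theory.

Local Open Scope classical_set_scope.
Local Open Scope ring_scope.

(* The graded pieces are given internally, as subspaces [homog n] of the total
   algebra A of which A is the direct sum. Since [algType rat] is a class of
   nontrivial rings, the zero algebra (which is never n-connected) is not a
   [cdgaType]. *)
HB.mixin Record isCDGA A of GRing.Algebra rat A := {
  homog : nat -> set A;
  cdga_diff : {linear A -> A};
  homog_submod : forall n, submod_closed [in homog n];
  homog_span : forall x : A, exists (N : nat) (c : nat -> A),
    (forall i, homog i (c i)) /\ x = \sum_(i < N) c i;
  homog_direct : forall (N : nat) (c : nat -> A),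
    (forall i, homog i (c i)) -> \sum_(i < N) c i = 0 ->
    forall i, (i < N)%N -> c i = 0;
  homog1 : homog 0%N 1;
  homogM : forall i j (x y : A),
    homog i x -> homog j y -> homog (i + j)%N (x * y);
  cdga_mulC : forall i j (x y : A),
    homog i x -> homog j y -> x * y = (-1) ^+ (i * j) * (y * x);
  homog_diff : forall i (x : A), homog i x -> homog i.+1 (cdga_diff x);
  cdga_diffK : forall x : A, cdga_diff (cdga_diff x) = 0;
  cdga_leibniz : forall i (x y : A), homog i x ->
    cdga_diff (x * y) = cdga_diff x * y + (-1) ^+ i * (x * cdga_diff y)
}.

#[short(type="cdgaType")]
HB.structure Definition CDGA := {A of isCDGA A & GRing.Algebra rat A}.

(* M is a nontrivial algebra over a field, so c |-> c%:A is injective and the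
   first clause says that it is an isomorphism from rat onto M^0. *)
Definition n_connected (n : nat) (M : cdgaType) : Prop :=
  homog 0%N = [set c%:A | c in [set: rat]] :> set M /\
  forall i, (1 <= i <= n)%N -> homog i = [set 0] :> set M.

HB.mixin Record isCDGAMorphism (M N : cdgaType) (f : M -> N) := {
  cdga_mor_homog : forall n x, homog n x -> homog n (f x);
  cdga_mor_diff : forall x, f (cdga_diff x) = cdga_diff (f x)
}.

HB.structure Definition CDGAMorphism (M N : cdgaType) :=
  {f of isCDGAMorphism M N f & @GRing.LRMorphism rat M N *:%R f}.

Notation "{ 'cdga' M -> N }" := (CDGAMorphism.type M N)
  (at level 0, M at level 98, N at level 99, format "{ 'cdga'  M  ->  N }")
  : type_scope.

Section Composition.
Variables (M N P : cdgaType) (f : {cdga N -> P}) (g : {cdga M -> N}).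

Lemma idfun_homog n (x : M) : homog n x -> homog n (idfun x).
Proof. by []. Qed.
Lemma idfun_diff (x : M) : idfun (cdga_diff x) = cdga_diff (idfun x).
Proof. by []. Qed.
HB.instance Definition _ :=
  isCDGAMorphism.Build M M idfun idfun_homog idfun_diff.

Lemma comp_homog n (x : M) : homog n x -> homog n ((f \o g) x).
Proof. by move=> hx; do 2!apply: cdga_mor_homog. Qed.
Lemma comp_diff (x : M) : (f \o g) (cdga_diff x) = cdga_diff ((f \o g) x).
Proof. by rewrite /= !cdga_mor_diff. Qed.
HB.instance Definition _ :=
  isCDGAMorphism.Build M P (f \o g) comp_homog comp_diff.
End Composition.

Definition is_cdga_aut (M : cdgaType) : set (M -> M) :=
  [set f : M -> M | exists a b : {cdga M -> M},
     [/\ f = a :> (M -> M), cancel a b & cancel b a]].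

Definition cdga_aut (M : cdgaType) := {f : M -> M | f \in @is_cdga_aut M}.

Section AutGroup.
Variable M : cdgaType.
Implicit Types f g h : cdga_aut M.

HB.instance Definition _ := Choice.on (cdga_aut M).

Lemma aut_oneP : idfun \in @is_cdga_aut M.
Proof. by rewrite inE; exists idfun, idfun. Qed.

Lemma aut_mulP f g : val f \o val g \in @is_cdga_aut M.
Proof.
case: f g => [f /= +] [g /= +]; rewrite !inE.
move=> [a [a' [-> aK a'K]]] [b [b' [-> bK b'K]]].
by exists (a \o b), (b' \o a'); split=> //; exact: can_comp.
Qed.

Definition aut_inv_fun f : M -> M :=
  xget (idfun : M -> M) [set g : M -> M | cancel (val f) g /\ cancel g (val f)].

Lemma aut_inv_funK f :
  cancel (val f) (aut_inv_fun f) /\ cancel (aut_inv_fun f) (val f).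
Proof.
rewrite /aut_inv_fun; case: xgetP => [_ _ []//|] nex.
case: f nex => [f /= +]; rewrite inE => -[a [b [-> aK bK]]].
by move=> /(_ b); case.
Qed.

Lemma aut_invP f : aut_inv_fun f \in @is_cdga_aut M.
Proof.
have [] := aut_inv_funK f; move: (aut_inv_fun f) => g.
case: f => [f /= +]; rewrite !inE => -[a [b [-> aK bK]]] agK gaK.
by exists b, a; split=> //; apply: funext => x; rewrite -{1}[x]bK agK.
Qed.

Definition aut_one : cdga_aut M :=
  exist (fun h : M -> M => h \in @is_cdga_aut M) _ aut_oneP.
Definition aut_mul f g : cdga_aut M :=
  exist (fun h : M -> M => h \in @is_cdga_aut M) _ (aut_mulP f g).
Definition aut_inv f : cdga_aut M :=
  exist (fun h : M -> M => h \in @is_cdga_aut M) _ (aut_invP f).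

Lemma aut_mulA : associative aut_mul.
Proof. by move=> f g h; apply: val_inj. Qed.
Lemma aut_mul1 : left_id aut_one aut_mul.
Proof. by move=> f; apply: val_inj. Qed.
Lemma aut_mulr1 : right_id aut_one aut_mul.
Proof. by move=> f; apply: val_inj. Qed.
Lemma aut_mulV : left_inverse aut_one aut_inv aut_mul.
Proof.
by move=> f; apply: val_inj; apply: funext => x; apply: (aut_inv_funK f).1.
Qed.
Lemma aut_mulrV : right_inverse aut_one aut_inv aut_mul.
Proof.
by move=> f; apply: val_inj; apply: funext => x; apply: (aut_inv_funK f).2.
Qed.

HB.instance Definition _ := isGroup.Build (cdga_aut M)
  aut_mulA aut_mul1 aut_mulr1 aut_mulV aut_mulrV.
End AutGroup.

Definition subgroup_of (G : groupType) (H : set G)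
  (Hgrp : group_closed [in H]) := {x : G | x \in H}.

Section Subgroup.
Variables (G : groupType) (H : set G) (Hgrp : group_closed [in H]).
HB.instance Definition _ := SubChoice.on (subgroup_of Hgrp).
HB.instance Definition _ :=
  SubChoice_isSubGroup.Build G [in H] (subgroup_of Hgrp) Hgrp.
End Subgroup.

Definition aut_mor_set (M1 M2 : cdgaType) (phi : {cdga M1 -> M2}) :
    set (cdga_aut M1 * cdga_aut M2) :=
  [set ab | val ab.2 \o phi = phi \o val ab.1].

Lemma aut_mor_group_closed (M1 M2 : cdgaType) (phi : {cdga M1 -> M2}) :
  group_closed [in aut_mor_set phi].
Proof.
split=> [|[a b] [a' b']]; rewrite !inE //= => /funeqP ab /funeqP ab'.
apply: funext => x /=; have [_ bK] := aut_inv_funK b'.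
have [b'K _] := aut_inv_funK b'; have [_ aK] := aut_inv_funK a'.
rewrite -[x in LHS]aK; have /= <- := ab' (aut_inv_fun a' x).
by rewrite b'K; exact: ab.
Qed.

Definition cdga_aut_mor (M1 M2 : cdgaType) (phi : {cdga M1 -> M2}) :=
  subgroup_of (aut_mor_group_closed phi).
HB.instance Definition _ M1 M2 (phi : {cdga M1 -> M2}) :=
  Group.on (cdga_aut_mor phi).

Definition group_isomorphic (G H : groupType) : Prop :=
  exists f : {multiplicative G -> H}, bijective f.

(* Main.v *)
Require Import Defs.
From HB Require Import structures.
From mathcomp Require Import all_boot all_order all_algebra.
From mathcomp Require Import boolp classical_sets functions wochoice.
From mathcomp Require Import zify ring.

(** A ternary relation T on a set Z is turned, contravariantly, into an
    n-connected algebra [model n (Z, T)] whose automorphisms are exactly those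
    of (Z, T).  The theorem is then a statement about relational structures:
    G1 and G2 have to be realised as automorphism groups of two of them, and H
    as the automorphism group of a homomorphism between the two.

    The algebra.  Let B be the disjoint union of Z and T, let R be the ring of
    all functions from B to the rationals, and let p > n be even.  The algebra
    has the rationals in degree 0, a copy R e_k of R in every degree k with
    p <= k < 3p except p + 1, and the functions on T in degree p + 1.  In it
    - (x e_i)(y e_j) is xy e_(i+j) if i or j is even, (j - i) xy e_(i+j) if both
      are odd, and 0 if i + j >= 3p;
    - the functions on T multiply all elements of positive degree to 0;
    - d(x e_k) = x e_(k+1) for odd k, and d(x e_p) is the function on T that
      sends t = (t1, t2, t3) to x(t) + 2 x(t1) + 4 x(t2) + 8 x(t3).
    Products of three elements of positive degree vanish for degree reasons, so
    associativity costs nothing.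

    Rigidity.  An automorphism acts on R e_k by a linear bijection a_k of R.
    The differential gives a_k = a_(k+1) for odd k, and each nonzero product
    gives a_i(x) a_j(y) = a_(i+j)(xy).  Without the odd products these equations
    would be solved by rescaling e_k by powers of a unit of R; the product of
    the odd layers p + 3 and p + 5, compared with that of the even layers
    p + 2 and p + 6, forces a_(p+4) = a_(p+2), and from there all a_k are equal
    ([act_eq]).  Their common value is a ring automorphism of R, hence comes
    from a permutation of B ([fun_alg_aut]).  This permutation preserves the
    kernel of d on R e_p, and the coefficients 1, 2, 4, 8 are chosen so that it
    must then map Z to Z and be induced by an automorphism of (Z, T)
    ([kernel_map], [model_aut]).

    The structures.  Z consists of the vertices and the labels of a graph with
    labelled arrows; T contains the arrows, together with a well-order of the
    labels, which an automorphism therefore fixes one by one ([labelled_aut]).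
    For G2 the graph is the Cayley graph of G2.  For G1 it is the Cayley graph
    of G1 enlarged by the set of all subsets of G1 x G2, on which G1 acts by
    translation; every subset Y has a label of its own, carried by the arrows
    from g to gY, which pins down how an automorphism moves Y.  Between subsets
    all arrows with labels in G2 are present, so any map from G2 to subsets is a
    graph map.  The map sending g to the set of (r, s) with (r, gs) in H
    satisfies g2 then map = map then g1 exactly when (g1, g2) lies in H
    ([coset_vertex_equivariant]). *)

Set Implicit Arguments.
Unset Strict Implicit.
Unset Printing Implicit Defensive.

Import GRing.Theory Num.Theory.

Local Open Scope classical_set_scope.
Local Open Scope ring_scope.

Definition supported (C : Type) (deg : C -> nat) (k : nat) (x : C -> rat^o) :=
  forall c, deg c != k -> x c = 0.

(** * Unitization of a graded algebra in which triple products vanish *)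

(** The positive-degree part of a connected algebra, presented as the space of
    all functions on a set of coordinates.  Degrees are bounded, so this space
    is the direct sum of its homogeneous parts even if there are infinitely many
    coordinates.  The vanishing of triple products replaces associativity. *)
Record nil_cdga := NilCDGA {
  coord : Type;
  degree : coord -> nat;
  top_degree : nat;
  degree_gt0 : forall c, (0 < degree c)%N;
  degree_lt : forall c, (degree c < top_degree)%N;
  nil_mul : (coord -> rat^o) -> (coord -> rat^o) -> (coord -> rat^o);
  nil_diff : (coord -> rat^o) -> (coord -> rat^o);
  nil_mulP : forall a x y z,
    nil_mul (a *: x + y) z = a *: nil_mul x z + nil_mul y z;
  nil_mulPr : forall a x y z,
    nil_mul z (a *: x + y) = a *: nil_mul z x + nil_mul z y;
  nil_mul3l : forall x y z, nil_mul (nil_mul x y) z = 0;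
  nil_mul3r : forall x y z, nil_mul x (nil_mul y z) = 0;
  nil_mul_supp : forall i j x y, supported degree i x -> supported degree j y ->
    supported degree (i + j) (nil_mul x y);
  nil_mulC : forall i j x y, supported degree i x -> supported degree j y ->
    nil_mul x y = (-1) ^+ (i * j) *: nil_mul y x;
  nil_diffP : forall a x y,
    nil_diff (a *: x + y) = a *: nil_diff x + nil_diff y;
  nil_diff_supp : forall i x, supported degree i x ->
    supported degree i.+1 (nil_diff x);
  nil_diffK : forall x, nil_diff (nil_diff x) = 0;
  nil_leibniz : forall i x y, supported degree i x ->
    nil_diff (nil_mul x y) =
      nil_mul (nil_diff x) y + (-1) ^+ i *: nil_mul x (nil_diff y)
}.

Definition unitization (N : nil_cdga) := (rat^o * (coord N -> rat^o))%type.

Section Unitization.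
Variable N : nil_cdga.
Notation A := (unitization N).
Notation V := (coord N -> rat^o).
Notation mul := (@nil_mul N).

HB.instance Definition _ :=
  GRing.Lmodule.copy A (rat^o * (coord N -> rat^o))%type.

Lemma nil_mulDl (x y z : V) : mul (x + y) z = mul x z + mul y z.
Proof. by have := nil_mulP 1 x y z; rewrite !scale1r. Qed.
Lemma nil_mulDr (x y z : V) : mul z (x + y) = mul z x + mul z y.
Proof. by have := nil_mulPr 1 x y z; rewrite !scale1r. Qed.
Lemma nil_mul0l (z : V) : mul 0 z = 0.
Proof. by apply: (addrI (mul 0 z)); rewrite -nil_mulDl !addr0. Qed.
Lemma nil_mul0r (z : V) : mul z 0 = 0.
Proof. by apply: (addrI (mul z 0)); rewrite -nil_mulDr !addr0. Qed.
Lemma nil_mulZl a (x z : V) : mul (a *: x) z = a *: mul x z.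
Proof. by have := nil_mulP a x 0 z; rewrite nil_mul0l !addr0. Qed.
Lemma nil_mulZr a (x z : V) : mul z (a *: x) = a *: mul z x.
Proof. by have := nil_mulPr a x 0 z; rewrite nil_mul0r !addr0. Qed.
Lemma nil_diffD (x y : V) : nil_diff (x + y) = nil_diff x + nil_diff y.
Proof. by have := nil_diffP 1 x y; rewrite !scale1r. Qed.
Lemma nil_diff0 : nil_diff (0 : V) = 0.
Proof. by apply: (addrI (nil_diff (0 : V))); rewrite -nil_diffD !addr0. Qed.
Lemma nil_diffZ a (x : V) : nil_diff (a *: x) = a *: nil_diff x.
Proof. by have := nil_diffP a x 0; rewrite nil_diff0 !addr0. Qed.

Definition umul (x y : A) : A :=
  (x.1 * y.1, x.1 *: y.2 + y.1 *: x.2 + mul x.2 y.2).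
Definition uone : A := (1, 0).

Lemma unitizationP (x y : A) : x.1 = y.1 -> x.2 = y.2 -> x = y.
Proof. by case: x y => [a u] [b v] /= -> ->. Qed.

Fact umulA : associative umul.
Proof.
move=> [a x] [b y] [c z]; apply: unitizationP => /=; first by rewrite mulrA.
rewrite !nil_mulDl !nil_mulDr !nil_mulZl !nil_mulZr nil_mul3l nil_mul3r !addr0.
rewrite !scalerDr !scalerA [c * a]mulrC [c * b]mulrC -!addrA.
do 2 congr (_ + _); rewrite [LHS]addrCA; congr (_ + _).
by rewrite addrA [LHS]addrC.
Qed.
Fact umul1l : left_id uone umul.
Proof.
move=> [a x]; apply: unitizationP => /=; first by rewrite mul1r.
by rewrite nil_mul0l scale1r scaler0 !addr0.
Qed.
Fact umul1r : right_id uone umul.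
Proof.
move=> [a x]; apply: unitizationP => /=; first by rewrite mulr1.
by rewrite nil_mul0r scale1r scaler0 add0r !addr0.
Qed.
Fact umulDl : left_distributive umul +%R.
Proof.
move=> [a x] [b y] [c z]; apply: unitizationP => /=; first by rewrite mulrDl.
rewrite nil_mulDl scalerDl scalerDr [RHS]addrACA.
by congr (_ + _); rewrite addrACA.
Qed.
Fact umulDr : right_distributive umul +%R.
Proof.
move=> [a x] [b y] [c z]; apply: unitizationP => /=; first by rewrite mulrDr.
rewrite nil_mulDr scalerDl scalerDr [RHS]addrACA.
by congr (_ + _); rewrite addrACA.
Qed.
Fact uone_neq0 : uone != 0.
Proof. by rewrite /uone; apply/eqP => -[/eqP]; rewrite oner_eq0. Qed.

HB.instance Definition _ := GRing.Zmodule_isNzRing.Build A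
  umulA umul1l umul1r umulDl umulDr uone_neq0.

Fact uscalerAl (a : rat) (x y : A) : a *: (x * y) = (a *: x) * y.
Proof.
apply: unitizationP; first exact: mulrA.
change (a *: (x.1 *: y.2 + y.1 *: x.2 + mul x.2 y.2) =
  (a * x.1) *: y.2 + y.1 *: (a *: x.2) + mul (a *: x.2) y.2).
by rewrite !scalerDr !scalerA nil_mulZl [y.1 * a]mulrC.
Qed.
HB.instance Definition _ :=
  GRing.LSemiModule_isLSemiAlgebra.Build rat A uscalerAl.
Fact uscalerAr (a : rat) (x y : A) : a *: (x * y) = x * (a *: y).
Proof.
apply: unitizationP; first exact: mulrCA.
change (a *: (x.1 *: y.2 + y.1 *: x.2 + mul x.2 y.2) =
  x.1 *: (a *: y.2) + (a * y.1) *: x.2 + mul x.2 (a *: y.2)).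
by rewrite !scalerDr !scalerA nil_mulZr [a * x.1]mulrC.
Qed.
HB.instance Definition _ :=
  GRing.LSemiAlgebra_isSemiAlgebra.Build rat A uscalerAr.

(** The scalar part is treated as one more coordinate, of degree 0, so that the
    direct sum decomposition needs no separate case in degree 0. *)
Definition ucoord (x : A) (o : option (coord N)) : rat^o :=
  if o is Some c then x.2 c else x.1.
Definition udegree (o : option (coord N)) : nat :=
  if o is Some c then degree c else 0%N.
Definition uhomog (k : nat) : set A := [set x | supported udegree k (ucoord x)].
Definition ugraft (g : option (coord N) -> rat^o) : A := (g None, g \o Some).

Lemma ucoordP (x y : A) : ucoord x =1 ucoord y -> x = y.
Proof.
move=> xy; apply: unitizationP; first exact: (xy None).
by apply: funext => c; apply: (xy (Some c)).
Qed.

Lemma ucoord_graft g : ucoord (ugraft g) = g.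
Proof. by apply: funext => -[]. Qed.

Lemma ucoord_linear a x y o :
  ucoord (a *: x + y) o = a * ucoord x o + ucoord y o.
Proof. by case: o. Qed.

Lemma ucoord0 o : ucoord 0 o = 0.
Proof. by case: o. Qed.

Lemma ucoord_sum m (c : nat -> A) o :
  ucoord (\sum_(i < m) c i) o = \sum_(i < m) ucoord (c i) o.
Proof.
by rewrite (big_morph (ucoord^~ o) (id1 := 0) (op1 := +%R)) //; case: o.
Qed.

Lemma uhomog0E (x : A) : uhomog 0 x <-> x.2 = 0.
Proof.
split=> [xh|x0 [c|] //= _]; last by rewrite x0.
by apply: funext => c; apply: (xh (Some c)); rewrite -lt0n degree_gt0.
Qed.

Lemma uhomogSE k (x : A) :
  uhomog k.+1 x <-> x.1 = 0 /\ supported (@degree N) k.+1 x.2.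
Proof.
split=> [xh|[x0 xh] [c|] //= ck]; last exact: xh.
by split=> [|c]; [apply: (xh None) | apply: (xh (Some c))].
Qed.

Fact uhomog_submod k : submod_closed [in uhomog k].
Proof.
split=> [|a x y]; rewrite !inE; first by move=> o _; rewrite ucoord0.
by move=> xh yh o ok; rewrite ucoord_linear xh ?yh // mulr0 addr0.
Qed.

Fact uhomog_span (x : A) : exists (m : nat) (c : nat -> A),
  (forall i, uhomog i (c i)) /\ x = \sum_(i < m) c i.
Proof.
exists (top_degree N).+1.
pose c i := ugraft (fun o => if udegree o == i then ucoord x o else 0).
exists c; split=> [i o|]; first by rewrite ucoord_graft; case: eqP.
apply: ucoordP => o; rewrite ucoord_sum.
have ltd : (udegree o < (top_degree N).+1)%N.
  by case: o => //= q; rewrite ltnS ltnW // degree_lt.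
rewrite (bigD1 (Ordinal ltd)) //= big1 ?addr0 ?ucoord_graft ?eqxx // => i.
by rewrite ucoord_graft -val_eqE /= eq_sym => /negbTE->.
Qed.

Fact uhomog_direct (m : nat) (c : nat -> A) : (forall i, uhomog i (c i)) ->
  \sum_(i < m) c i = 0 -> forall i, (i < m)%N -> c i = 0.
Proof.
move=> ch c0 i im; apply: ucoordP => o; rewrite ucoord0.
have [oi|/(ch i)//] := eqVneq (udegree o) i.
have := congr1 (ucoord^~ o) c0; rewrite ucoord_sum ucoord0.
rewrite (bigD1 (Ordinal im)) //= big1 ?addr0 // => j.
by rewrite -val_eqE /= eq_sym -oi => /ch.
Qed.

Fact uhomog1 : uhomog 0 (1 : A).
Proof. exact/uhomog0E. Qed.

Lemma supportedZ k a (x : V) : supported (@degree N) k x ->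
  supported (@degree N) k (a *: x).
Proof.
by move=> xk c /xk xc; have -> : (a *: x) c = a * x c by []; rewrite xc mulr0.
Qed.

Fact uhomogM i j (x y : A) : uhomog i x -> uhomog j y -> uhomog (i + j) (x * y).
Proof.
case: i j => [|i] [|j].
- move=> /uhomog0E x0 /uhomog0E y0; apply/uhomog0E => /=.
  by rewrite x0 y0 nil_mul0r !scaler0 !addr0.
- move=> /uhomog0E x0 /uhomogSE[y0 yh]; apply/uhomogSE => /=.
  rewrite x0 y0 mulr0 nil_mul0l scale0r !addr0.
  by split=> //; apply: supportedZ.
- move=> /uhomogSE[x0 xh] /uhomog0E y0; rewrite addn0; apply/uhomogSE => /=.
  rewrite x0 y0 mul0r nil_mul0r scale0r addr0 add0r.
  by split=> //; apply: supportedZ.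
move=> /uhomogSE[x0 xh] /uhomogSE[y0 yh]; apply/uhomogSE => /=.
rewrite x0 y0 mulr0 !scale0r !add0r.
by split=> //; exact: (nil_mul_supp xh yh).
Qed.

Fact umulC i j (x y : A) : uhomog i x -> uhomog j y ->
  x * y = (-1) ^+ (i * j) * (y * x).
Proof.
rewrite -signr_odd mulr_sign -scaler_sign signr_odd.
case: i j => [|i] [|j].
- move=> /uhomog0E x0 /uhomog0E y0; rewrite scale1r; apply: unitizationP => /=.
    exact: mulrC.
  by rewrite x0 y0 !scaler0 addr0.
- move=> /uhomog0E x0 /uhomogSE[y0 yh]; rewrite scale1r.
  apply: unitizationP => /=.
    exact: mulrC.
  by rewrite x0 nil_mul0l nil_mul0r [LHS]addrAC addrC addrA addrAC.
- move=> /uhomogSE[x0 xh] /uhomog0E y0; rewrite muln0 scale1r.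
  apply: unitizationP => /=; first exact: mulrC.
  by rewrite y0 nil_mul0l nil_mul0r [LHS]addrAC addrC addrA addrAC.
move=> /uhomogSE[x0 xh] /uhomogSE[y0 yh]; apply: unitizationP.
  by rewrite /= x0 y0 !mulr0 scaler0.
change (x.1 *: y.2 + y.1 *: x.2 + mul x.2 y.2 =
  (-1) ^+ (i.+1 * j.+1) *: (y.1 *: x.2 + x.1 *: y.2 + mul y.2 x.2)).
by rewrite x0 y0 !scale0r !add0r (nil_mulC xh yh).
Qed.

Definition udiff (x : A) : A := (0, nil_diff x.2).
Fact udiff_linear : linear udiff.
Proof.
move=> a x y; apply: unitizationP; first by rewrite /= scaler0 addr0.
exact: nil_diffP.
Qed.
HB.instance Definition _ :=
  GRing.isLinear.Build rat A A *:%R udiff udiff_linear.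

Fact uhomog_diff i (x : A) : uhomog i x -> uhomog i.+1 (udiff x).
Proof.
case: i => [/uhomog0E x0|i /uhomogSE[_ xh]]; apply/uhomogSE; split=> //=.
  by rewrite x0 nil_diff0.
exact: nil_diff_supp.
Qed.

Fact udiffK (x : A) : udiff (udiff x) = 0.
Proof. by rewrite /udiff /= nil_diffK. Qed.

Fact uleibniz i (x y : A) : uhomog i x ->
  udiff (x * y) = udiff x * y + (-1) ^+ i * (x * udiff y).
Proof.
rewrite -signr_odd mulr_sign -scaler_sign signr_odd => xi.
apply: unitizationP; first by rewrite /= mul0r mulr0 scaler0 add0r.
change (nil_diff (x.1 *: y.2 + y.1 *: x.2 + mul x.2 y.2) =
  0 *: y.2 + y.1 *: nil_diff x.2 + mul (nil_diff x.2) y.2 +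
  (-1) ^+ i *: (x.1 *: nil_diff y.2 + 0 *: x.2 + mul x.2 (nil_diff y.2))).
rewrite !nil_diffD !nil_diffZ !scale0r add0r addr0.
case: i xi => [/uhomog0E x0|i /uhomogSE[x0 xh]].
  by rewrite x0 nil_diff0 !nil_mul0l nil_diff0 scaler0 !addr0 scale1r add0r.
by rewrite x0 !scale0r !add0r (nil_leibniz _ xh) addrA.
Qed.

HB.instance Definition _ := isCDGA.Build A uhomog_submod uhomog_span
  uhomog_direct uhomog1 uhomogM umulC uhomog_diff udiffK uleibniz.
End Unitization.

(** * The algebra of a ternary relation *)

Record ternary := Ternary {
  node : Type;
  tern : node * node * node -> Prop
}.

Definition edge (S : ternary) := {t | @tern S t}.
Definition cell (S : ternary) := (node S + edge S)%type.

(** Any two subsets of the weights 1, 2, 4, 8 have different sums; this is what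
    lets [kernel_map] tell an edge and its three end points apart. *)
Definition incidence (S : ternary) (x : cell S -> rat^o) : edge S -> rat^o :=
  fun e => x (inr e) + 2 * x (inl (sval e).1.1) + 4 * x (inl (sval e).1.2)
           + 8 * x (inl (sval e).2).

(** The lowest degree p: even, above n, and large enough for the products of
    degree 2p + 8 used in [act_base2] to stay below 3p. *)
Definition base (n : nat) : nat := (n + 5).*2.
(** Degree p + 1 is kept free of layers: there the functions on edges live, and
    an automorphism cannot mix the two. *)
Definition layer (n k : nat) : bool :=
  (base n <= k < 3 * base n)%N && (k != (base n).+1).
Definition slot (n : nat) (S : ternary) :=
  ({k | layer n k} * cell S + edge S)%type.
Definition slot_degree n S (c : slot n S) : nat :=
  match c with inl kb => val kb.1 | inr _ => (base n).+1 end.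

(** Graded commutativity asks for a value antisymmetric in (i, j) when both are
    odd.  The Leibniz rule leaves that value free: the product of two odd layers
    is closed, and the other two terms of the rule cancel. *)
Definition structure_const (i j : nat) : rat :=
  if odd i && odd j then j%:R - i%:R else 1.

Section Layers.
Variables (n : nat) (S : ternary).
Notation p := (base n).
Notation R := (cell S -> rat^o).
Notation V := (slot n S -> rat^o).
Notation eps := structure_const.
Notation sdeg := (@slot_degree n S).

(** The value 0 at degrees without a layer makes the formulas for products and
    differentials uniform in the degree. *)
Definition part (x : V) (k : nat) : R :=
  if insub k is Some k' then fun b => x (inl (k', b)) else 0.
Definition of_parts (g : nat -> R) (h : edge S -> rat^o) : V :=
  fun c => match c with inl kb => g (val kb.1) kb.2 | inr e => h e end.

Lemma part_of_parts g h k :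
  part (of_parts g h) k = if layer n k then g k else 0.
Proof.
rewrite /part; case: insubP => [k' lk <-|/negbTE->//]; rewrite (valP k').
exact: funext.
Qed.

Lemma part_out x k : ~~ layer n k -> part x k = 0.
Proof. by move=> nlk; rewrite /part insubN. Qed.

Lemma part_val (x : V) (k : {k | layer n k}) b :
  part x (val k) b = x (inl (k, b)).
Proof. by rewrite /part valK. Qed.

Lemma partP (x y : V) : (forall k, layer n k -> part x k = part y k) ->
  (forall e, x (inr e) = y (inr e)) -> x = y.
Proof.
move=> xy xye; apply: funext => -[[k b]|//].
by rewrite -!part_val xy // (valP k).
Qed.

Lemma part_lin a x y k : part (a *: x + y) k = a *: part x k + part y k.
Proof.
rewrite /part; case: insubP => [k' _ _|_]; first exact: funext.
by rewrite scaler0 addr0.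
Qed.

Lemma part_supp i x k : supported sdeg i x -> i != k -> part x k = 0.
Proof.
move=> xi ik; rewrite /part; case: insubP => // k' _ vk.
by apply: funext => b; apply: xi; rewrite /= vk eq_sym.
Qed.

Lemma supported_partP i x : supported sdeg i x <->
  (forall k, k != i -> part x k = 0) /\ (i != p.+1 -> forall e, x (inr e) = 0).
Proof.
split=> [xi|[xk xe] [[k b]|e] /=].
- split=> [k ki|ip e]; first by rewrite (part_supp xi) // eq_sym.
  by apply: xi; rewrite eq_sym.
- by move=> ki; rewrite -part_val xk.
- by rewrite eq_sym => /xe.
Qed.

Definition lmul (x y : V) : V :=
  of_parts (fun k =>
    \sum_(i < k.+1) eps i (k - i) *: (part x i * part y (k - i))) 0.
Definition ldiff (x : V) : V :=
  of_parts (fun k => if odd k then 0 else part x k.-1) (incidence (part x p)).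

Lemma part_mul x y k : part (lmul x y) k = if layer n k then
  \sum_(i < k.+1) eps i (k - i) *: (part x i * part y (k - i)) else 0.
Proof. exact: part_of_parts. Qed.

Lemma part_diff x k : part (ldiff x) k =
  if layer n k && ~~ odd k then part x k.-1 else 0.
Proof. by rewrite part_of_parts; case: ifP => //= _; case: ifP. Qed.

Lemma part_mul_supp i x y k : supported sdeg i x -> part (lmul x y) k =
  if layer n k && (i <= k)%N then eps i (k - i) *: (part x i * part y (k - i))
  else 0.
Proof.
move=> xi; rewrite part_mul; case: ifP => //= _; case: leqP => [ik|ki].
  rewrite (bigD1 (Ordinal (ik : (i < k.+1)%N))) //= big1 ?addr0 // => j.
  rewrite -val_eqE /= eq_sym => /(part_supp xi)->.
  by rewrite mul0r scaler0.
rewrite big1 // => j _; rewrite (part_supp xi) ?mul0r ?scaler0 //.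
by rewrite neq_ltn orbC (leq_trans (ltn_ord j)).
Qed.

Lemma incidence_lin a x y :
  incidence (a *: x + y : R) = a *: incidence x + incidence y.
Proof.
by apply: funext => e; rewrite /incidence !fctE /GRing.scale /=; ring.
Qed.

Lemma incidence0 : incidence (0 : R) = 0.
Proof.
apply: funext => e.
by change (0 + 2 * 0 + 4 * 0 + 8 * 0 = 0 :> rat); rewrite !mulr0 !addr0.
Qed.

Lemma mul_linl (e a : rat) (u v w : R) :
  e *: ((a *: u + v) * w) = a *: (e *: (u * w)) + e *: (v * w).
Proof. by apply: funext => b; rewrite !fctE /GRing.scale /=; ring. Qed.

Lemma mul_linr (e a : rat) (u v w : R) :
  e *: (w * (a *: u + v)) = a *: (e *: (w * u)) + e *: (w * v).
Proof. by apply: funext => b; rewrite !fctE /GRing.scale /=; ring. Qed.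

Fact lmulP a x y z : lmul (a *: x + y) z = a *: lmul x z + lmul y z.
Proof.
apply: partP => [k lk|e]; last by rewrite !fctE scaler0 addr0.
rewrite part_lin !part_mul lk scaler_sumr -big_split; apply: eq_bigr => i _.
by rewrite part_lin mul_linl.
Qed.

Fact lmulPr a x y z : lmul z (a *: x + y) = a *: lmul z x + lmul z y.
Proof.
apply: partP => [k lk|e]; last by rewrite !fctE scaler0 addr0.
rewrite part_lin !part_mul lk scaler_sumr -big_split; apply: eq_bigr => i _.
by rewrite part_lin mul_linr.
Qed.

Lemma part_low x k : (k < p)%N -> part x k = 0.
Proof. by move=> kp; rewrite part_out // /layer leqNgt kp. Qed.

Lemma part_mul_low x y k : (k < 2 * p)%N -> part (lmul x y) k = 0.
Proof.
move=> kp; rewrite part_mul; case: ifP => // _; rewrite big1 // => i _.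
have [ip|pi] := ltnP i p; first by rewrite part_low // mul0r scaler0.
by rewrite [part y _]part_low ?mulr0 ?scaler0 //; lia.
Qed.

(** A product lives in degree at least 2p, so a triple product would live in
    degree at least 3p. *)
Fact lmul3l x y z : lmul (lmul x y) z = 0.
Proof.
apply: partP => // k lk; rewrite part_mul lk big1 ?part_lin => [|i _].
  by rewrite /part; case: insub.
have [ip|pi] := ltnP i (2 * p); first by rewrite part_mul_low // mul0r scaler0.
rewrite [part z _]part_low ?mulr0 ?scaler0 //.
by move: lk; rewrite /layer; lia.
Qed.

Fact lmul3r x y z : lmul x (lmul y z) = 0.
Proof.
apply: partP => // k lk; rewrite part_mul lk big1 => [|i _].
  by rewrite /part; case: insub.
have [ip|pi] := ltnP i p; first by rewrite part_low // mul0r scaler0.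
rewrite part_mul_low ?mulr0 ?scaler0 //.
by move: lk; rewrite /layer; lia.
Qed.

Fact lmul_supp i j x y : supported sdeg i x -> supported sdeg j y ->
  supported sdeg (i + j) (lmul x y).
Proof.
move=> xi yj; apply/supported_partP; split=> // k kij.
rewrite (part_mul_supp _ _ xi); case: ifP => // /andP[_ ik].
by rewrite (part_supp yj) ?mulr0 ?scaler0 //; lia.
Qed.

Fact lmulC i j x y : supported sdeg i x -> supported sdeg j y ->
  lmul x y = (-1) ^+ (i * j) *: lmul y x.
Proof.
move=> xi yj; apply: partP => [k lk|e]; last first.
  by rewrite !fctE /= scaler0.
rewrite -[X in _ = part X _]addr0 part_lin.
have -> : part (0 : V) k = 0 by rewrite /part; case: insub.
rewrite addr0 (part_mul_supp _ _ xi) (part_mul_supp _ _ yj) lk /=.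
have [kij|kij] := eqVneq k (i + j)%N; last first.
  have y0 : (i <= k)%N -> part y (k - i) = 0.
    by move=> ik; apply: (part_supp yj); lia.
  have x0 : (j <= k)%N -> part x (k - j) = 0.
    by move=> jk; apply: (part_supp xi); lia.
  by case: (leqP i k) => [/y0->|_]; case: (leqP j k) => [/x0->|_];
    rewrite ?mulr0 ?scaler0.
have -> : (i <= k)%N by lia.
have -> : (j <= k)%N by lia.
rewrite kij addKn addnK scalerA [part y j * _]mulrC; congr (_ *: _).
rewrite /eps -signr_odd oddM [odd j && _]andbC.
by case: (odd i && odd j); rewrite ?expr1 ?expr0 ?mul1r // mulN1r opprB.
Qed.

Fact ldiffP a x y : ldiff (a *: x + y) = a *: ldiff x + ldiff y.
Proof.
apply: partP => [k lk|e].
  rewrite part_lin !part_diff lk /=; case: ifP => _; first exact: part_lin.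
  by rewrite scaler0 addr0.
by rewrite {1}/ldiff /= part_lin incidence_lin.
Qed.

Fact ldiff_supp i x : supported sdeg i x -> supported sdeg i.+1 (ldiff x).
Proof.
move=> xi; apply/supported_partP; split=> [k ki|ip e].
  rewrite part_diff; case: ifP => // /andP[lk _]; apply: (part_supp xi).
  by move: lk; rewrite /layer /base; lia.
have ip' : i != p by rewrite -eqSS.
by rewrite /= (part_supp xi ip') incidence0.
Qed.

(** A layer reached by d has even degree; only layer p among the even ones has a
    nonzero differential, and layer p is not reached because p - 1 is not a
    layer. *)
Fact ldiffK x : ldiff (ldiff x) = 0.
Proof.
have c0 k : part (ldiff (ldiff x)) k = 0.
  rewrite !part_diff; case: ifP => // /andP[lk ok].
  by case: ifP => // /andP[lk' ok']; move: lk lk'; rewrite /layer /base; lia.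
apply: partP => [k _|e]; first by rewrite c0 /part; case: insub.
rewrite /ldiff /= part_diff.
have -> : part x p.-1 = 0 by rewrite part_low // /base; lia.
by rewrite if_same incidence0.
Qed.

(** In degree k = i + m + 1 the rule is an identity between structure
    constants.  It holds because a constant with an even index is 1; for i and m
    both odd it reads 0 = 1 - 1. *)
Fact lleibniz i x y : supported sdeg i x ->
  ldiff (lmul x y) = lmul (ldiff x) y + (-1) ^+ i *: lmul x (ldiff y).
Proof.
move=> xi; apply: partP => [k lk|e]; last first.
  rewrite !fctE /= part_mul_low; last by rewrite /base; lia.
  by rewrite incidence0 scaler0 addr0.
rewrite addrC part_lin part_diff !(part_mul_supp _ _ xi).
rewrite (part_mul_supp _ _ (ldiff_supp xi)) !part_diff lk /=.
have [li|nli] := boolP (layer n i); last first.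
  by rewrite (part_out x nli) !if_same !mul0r !scaler0 !if_same ?scaler0 addr0.
have [ik|ki] := ltnP i k; last first.
  have -> : (i <= k.-1)%N = false by move: lk; rewrite /layer /base; lia.
  have -> : (k - i = 0)%N by lia.
  have -> : layer n 0 = false by rewrite /layer /base; lia.
  by rewrite andbF if_same mulr0 scaler0 if_same scaler0 addr0.
rewrite (ltnW ik); set m := (k - i.+1)%N.
have -> : (k.-1 - i = m)%N by rewrite /m; lia.
have -> : (k - i = m.+1)%N by rewrite /m; lia.
have [lm|nlm] := boolP (layer n m); last first.
  by rewrite (part_out y nlm) !if_same !mulr0 !scaler0 ?if_same addr0.
have km : k = (i + m).+1 by rewrite /m; lia.
have -> : layer n k.-1 && (i <= k.-1)%N.
  by move: li lm lk; rewrite km /layer /base; lia.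
have oi : layer n i.+1 && odd i = odd i.
  by move: li lm lk; rewrite km /layer /base; lia.
have om : layer n m.+1 && odd m = odd m.
  by move: li lm lk; rewrite km /layer /base; lia.
rewrite /= !negbK oi om km /= negbK oddD -signr_odd /eps /=.
case: (odd i) (odd m) => -[] /=.
- by rewrite scaleN1r !scale1r addNr.
- by rewrite mulr0 !scaler0 add0r.
- by rewrite mul0r expr0 !scale1r scaler0 addr0.
- by rewrite mul0r mulr0 !scaler0 addr0.
Qed.

Fact slot_degree_gt0 (c : slot n S) : (0 < sdeg c)%N.
Proof. by case: c => [[[k lk] b]|//] /=; move: lk; rewrite /layer /base; lia. Qed.
Fact slot_degree_lt (c : slot n S) : (sdeg c < 3 * p)%N.
Proof.
by case: c => [[[k lk] b]|e] /=; [move: lk|]; rewrite /layer /base; lia.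
Qed.

Definition layered : nil_cdga := NilCDGA slot_degree_gt0 slot_degree_lt
  lmulP lmulPr lmul3l lmul3r lmul_supp lmulC ldiffP ldiff_supp ldiffK lleibniz.
End Layers.

(** * Connectivity and functoriality *)

Definition model (n : nat) (S : ternary) : cdgaType :=
  unitization (layered n S).

Lemma model_connected n S : n_connected n (model n S).
Proof.
split=> [|i /andP[i1 ni]]; apply/seteqP; split.
- move=> x /uhomog0E x0; exists x.1 => //.
  apply: unitizationP; first exact: mulr1.
  by rewrite x0; exact: scaler0.
- by move=> _ [c _ <-]; apply/uhomog0E; apply: scaler0.
- case: i i1 ni => // i _ ni x /uhomogSE[x0 xi]; apply: unitizationP => //.
  apply: funext => c; apply: xi; rewrite neq_ltn orbC.
  suff: (n < slot_degree c)%N by move/(leq_ltn_trans ni)->.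
  by case: c => [[[k lk] b]|e] /=; [move: lk|]; rewrite /layer /base; lia.
- by move=> x /= ->; case: (@homog_submod (model n S) i); rewrite inE.
Qed.

Definition map3 (X Y : Type) (u : X -> Y) (t : X * X * X) : Y * Y * Y :=
  (u t.1.1, u t.1.2, u t.2).

Definition tern_hom (S T : ternary) :=
  {u : node S -> node T | forall t, tern t -> tern (map3 u t)}.

Section Pullback.
Variables (n : nat) (S T : ternary) (u : tern_hom S T).

Definition edge_map (e : edge S) : edge T :=
  exist (@tern T) (map3 (sval u) (sval e)) (svalP u _ (svalP e)).
Definition cell_map (b : cell S) : cell T :=
  match b with inl z => inl (sval u z) | inr e => inr (edge_map e) end.
Definition slot_map (c : slot n S) : slot n T :=
  match c with
  | inl kb => inl (kb.1, cell_map kb.2)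
  | inr e => inr (edge_map e)
  end.
Definition pull (x : model n T) : model n S := (x.1, x.2 \o slot_map).

Lemma part_pull (x : slot n T -> rat^o) k :
  part (x \o slot_map) k = part x k \o cell_map.
Proof. by rewrite /part; case: insub. Qed.

Lemma lmul_pull (x y : slot n T -> rat^o) :
  lmul (x \o slot_map) (y \o slot_map) = lmul x y \o slot_map.
Proof.
apply: partP => // k lk; rewrite part_pull !part_mul lk.
apply: funext => b /=; rewrite fct_sumE /= fct_sumE; apply: eq_bigr => i _.
by rewrite !part_pull.
Qed.

Lemma incidence_pull (x : cell T -> rat^o) :
  incidence (x \o cell_map) = incidence x \o edge_map.
Proof. by []. Qed.

Lemma ldiff_pull (x : slot n T -> rat^o) :
  ldiff (x \o slot_map) = ldiff x \o slot_map.
Proof.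
apply: partP => [k lk|e]; last by rewrite /= part_pull incidence_pull.
by rewrite part_pull !part_diff part_pull; case: ifP.
Qed.

Lemma slot_degree_map c : slot_degree (slot_map c) = slot_degree c.
Proof. by case: c. Qed.

Fact pull_linear : linear pull.
Proof. by []. Qed.
Fact pull_monoid : monoid_morphism pull.
Proof.
split=> // x y; apply: unitizationP => //=.
by rewrite lmul_pull.
Qed.
Fact pull_homog k (x : model n T) : homog k x -> homog k (pull x).
Proof.
move=> xk [c|] // ck; last exact: (xk None).
by apply: (xk (Some (slot_map c))); rewrite /= slot_degree_map.
Qed.
Fact pull_diff (x : model n T) : pull (cdga_diff x) = cdga_diff (pull x).
Proof. by apply: unitizationP => //; apply/esym/ldiff_pull. Qed.

HB.instance Definition _ :=
  GRing.isLinear.Build rat (model n T) (model n S) *:%R pull pull_linear.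
HB.instance Definition _ :=
  GRing.isMonoidMorphism.Build (model n T) (model n S) pull pull_monoid.
HB.instance Definition _ :=
  isCDGAMorphism.Build (model n T) (model n S) pull pull_homog pull_diff.
End Pullback.

Lemma pull_ext n S T (u v : tern_hom S T) : sval u =1 sval v ->
  pull u = pull v :> (model n T -> model n S).
Proof.
move=> uv; suff -> : u = v by [].
case: u v uv => [u uh] [v vh] /= uv.
by apply: eq_exist; apply: funext.
Qed.

Lemma pull_comp n S T U (u : tern_hom S T) (v : tern_hom T U)
    (w : tern_hom S U) : sval w =1 sval v \o sval u ->
  pull u \o pull v = pull w :> (model n U -> model n S).
Proof.
case: w => w wh /= wE.
have vuh q : tern q -> tern (map3 (sval v \o sval u) q).
  by move=> qS; apply: (svalP v (map3 _ _)); apply: (svalP u).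
rewrite -(@pull_ext _ _ _ (exist _ _ vuh)) => [|z]; last by rewrite /= wE.
apply: funext => x; apply: unitizationP => //=; apply: funext => c /=.
congr (x.2 _); case: c => [[k [z|e]]|e] //=.
  by congr (inl (_, inr _)); apply: eq_exist.
by congr inr; apply: eq_exist.
Qed.

Lemma pull_id n S (u : tern_hom S S) : sval u =1 id ->
  pull u = id :> (model n S -> model n S).
Proof.
have idh q : @tern S q -> tern (map3 id q) by case: q => -[].
move=> u1; rewrite (@pull_ext _ _ _ _ (exist _ id idh)) //.
apply: funext => x; apply: unitizationP => //=; apply: funext => c /=.
by congr (x.2 _); case: c => [[k [z|[[[a b] d] e]]]|[[[a b] d] e]] //=;
   [congr (inl (_, inr _)) | congr inr]; apply: eq_exist.
Qed.

(** * Linear algebra of functions on a set *)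

Section Indicator.
Variable B : Type.
Notation R := (B -> rat^o).

Definition indic (c : B) : R := fun b => `[< b = c >]%:R.

Lemma indicE c : indic c c = 1.
Proof. by rewrite /indic asboolT. Qed.

Lemma mul_indic (x : R) c : x * indic c = x c *: indic c.
Proof.
apply: funext => b; change (x b * indic c b = x c * indic c b).
by rewrite /indic; case: asboolP => [->//|_]; rewrite !mulr0.
Qed.

Lemma indic_neq0 c : indic c <> 0.
Proof. by move/(congr1 (@^~ c)); rewrite indicE => /eqP; rewrite oner_eq0. Qed.

Lemma idemp_eq1 (a : rat) : a * a = a -> a != 0 -> a = 1.
Proof. by move=> aa a0; apply: (mulfI a0); rewrite aa mulr1. Qed.

(** A ring automorphism permutes the minimal idempotents, which are the
    indicator functions of points, and the product with such an idempotent reads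
    off the value of a function at a point.  On an infinite set the preimage of
    an indicator function is still a nonzero idempotent, so it takes the value 1
    somewhere; that place is the value of the permutation. *)
Lemma fun_alg_aut (f g : R -> R) : cancel f g -> cancel g f ->
  (forall a x, f (a *: x) = a *: f x) -> {morph f : x y / x * y} ->
  exists t : B -> B, forall x, f x = x \o t.
Proof.
move=> fK gK fZ fM.
have f0 : f 0 = 0 by rewrite -(scale0r (0 : R)) fZ scale0r.
have gM x y : g (x * y) = g x * g y by rewrite -{1}[x]gK -{1}[y]gK -fM fK.
suff /choice[t ft] : forall b, exists c, forall x, f x b = x c.
  by exists t => x; apply: funext => b; apply: ft.
move=> b; pose e := g (indic b).
have ee : e * e = e by rewrite -gM mul_indic indicE scale1r.
have [c ec] : exists c, e c != 0.
  apply: contrapT => /forallNP e0; apply: (@indic_neq0 b).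
  rewrite -[LHS]gK -/e -f0; congr f; apply: funext => c.
  by apply: contrapT => /eqP ec; apply: (e0 c).
have {}ec : e c = 1 by apply: idemp_eq1 => //; exact: (congr1 (@^~ c) ee).
have fcb : f (indic c) * indic b = f (indic c).
  by rewrite -[indic b]gK -/e -fM mulrC mul_indic ec scale1r.
have {}fcb : f (indic c) = f (indic c) b *: indic b by rewrite -mul_indic.
have v1 : f (indic c) b = 1.
  apply: idemp_eq1.
    have := fM (indic c) (indic c); rewrite mul_indic indicE scale1r.
    by move/(congr1 (@^~ b)).
  apply/eqP => v0; apply: (@indic_neq0 c).
  by rewrite -[LHS]fK fcb v0 scale0r -f0 fK.
exists c => x; have := fM x (indic c); rewrite mul_indic fZ.
by move/(congr1 (@^~ b)); rewrite !fctE /GRing.scale /= v1 !mulr1.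
Qed.
End Indicator.

Lemma binary_digits (b1 b2 b3 c1 c2 c3 : bool) :
  - (2 * b1%:R + 4 * b2%:R + 8 * b3%:R) + 2 * c1%:R + 4 * c2%:R + 8 * c3%:R
    = 0 :> rat -> [/\ b1 = c1, b2 = c2 & b3 = c3].
Proof. by case: b1 b2 b3 c1 c2 c3 => -[] [] [] [] [] /eqP; vm_compute. Qed.

Section KernelMap.
Variables (S : ternary).
Notation R := (cell S -> rat^o).

(** Kernel elements of [incidence] are free on nodes and forced on edges. *)
Definition solution (y : node S -> rat) : R := fun b =>
  match b with
  | inl z => y z
  | inr e => - (2 * y (sval e).1.1 + 4 * y (sval e).1.2 + 8 * y (sval e).2)
  end.

Lemma incidence_solution y : incidence (solution y) = 0.
Proof.
apply: funext => e; rewrite /incidence /=.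
by change (0 e) with (0 : rat); ring.
Qed.

(** The kernel contains the function equal to 1 on nodes and -14 on edges, and
    1 + 2 + 4 + 8 = 15.  Its weighted sum over the images of an edge and of the
    three end points vanishes only if the cells sent to edges have total weight
    1, so the edge itself is sent to an edge and the end points to nodes.  The
    kernel elements that extend indicator functions of nodes then identify the
    end points. *)
Lemma kernel_map (t : cell S -> cell S) :
  (forall x : R, incidence x = 0 -> incidence (x \o t) = 0) ->
  forall e, exists e', t (inr e) = inr e' /\
    [/\ t (inl (sval e).1.1) = inl (sval e').1.1,
        t (inl (sval e).1.2) = inl (sval e').1.2
      & t (inl (sval e).2) = inl (sval e').2].
Proof.
move=> tK e.
have {}tK y : solution y (t (inr e)) + 2 * solution y (t (inl (sval e).1.1))
    + 4 * solution y (t (inl (sval e).1.2))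
    + 8 * solution y (t (inl (sval e).2)) = 0.
  by have := congr1 (@^~ e) (tK _ (incidence_solution y)).
move: (t (inr e)) (t (inl _)) (t (inl (sval e).1.2)) (t (inl (sval e).2)) tK.
move=> b0 b1 b2 b3 tK; have := tK (fun=> 1).
case: b0 b1 b2 b3 tK => [z0|e0] [z1|e1] [z2|e2] [z3|e3] tK /= tK1;
  try by exfalso; move/eqP: tK1; vm_compute.
exists e0; split; first reflexivity.
have dec z := binary_digits (tK (fun w => `[< w = z >]%:R)).
have /asboolP e1 : `[< (sval e0).1.1 = z1 >].
  by have [-> _ _] := dec z1; rewrite asboolT.
have /asboolP e2 : `[< (sval e0).1.2 = z2 >].
  by have [_ -> _] := dec z2; rewrite asboolT.
have /asboolP e3 : `[< (sval e0).2 = z3 >].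
  by have [_ _ ->] := dec z3; rewrite asboolT.
by rewrite {tK tK1 dec}e1 e2 e3.
Qed.
End KernelMap.

(** * Rigidity *)

Lemma cdga_morZ (M N : cdgaType) (f : {cdga M -> N}) (a : rat) (x : M) :
  f (a *: x) = a *: f x.
Proof. exact: (linearZZ (f : {linear M -> N})). Qed.

Section Rigidity.
Variables (n : nat) (S : ternary).
Notation p := (base n).
Notation M := (model n S).
Notation R := (cell S -> rat^o).

Definition lay (k : nat) (r : R) : M :=
  (0, of_parts (fun j => if j == k then r else 0) 0).
Definition edge_elt (h : edge S -> rat^o) : M := (0, of_parts (fun=> 0) h).

Lemma part_lay k r j :
  part (lay k r).2 j = if layer n j && (j == k) then r else 0.
Proof. by rewrite part_of_parts; case: ifP => //= _; case: ifP. Qed.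

Lemma part0 j : part (0 : slot n S -> rat^o) j = 0.
Proof. by rewrite /part; case: insub. Qed.

Lemma layP (x : M) k r : x.1 = 0 -> (forall j, layer n j ->
    part x.2 j = if j == k then r else 0) -> (forall e, x.2 (inr e) = 0) ->
  x = lay k r.
Proof.
move=> x0 xk xe; apply: unitizationP => //.
by apply: partP => // j lj; rewrite xk // part_lay lj.
Qed.

Lemma layZ a k r : lay k (a *: r) = a *: lay k r.
Proof.
apply/esym/layP => [|j lj|e]; rewrite ?mulr0 //=.
- exact: scaler0.
- have := part_lin a (lay k r).2 0 j; rewrite part0 !addr0 part_lay lj /= => ->.
  by case: ifP; rewrite ?scaler0.
- exact: scaler0.
Qed.

Lemma homog_lay k r : layer n k -> homog k (lay k r).
Proof.
move=> lk [[[j b]|e]|] //=.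
by move=> /negbTE ->.
Qed.

Lemma homog_layE k (x : M) : layer n k -> homog k x -> x = lay k (part x.2 k).
Proof.
case: k => [|k lk /uhomogSE[x0 xk]]; first by rewrite /layer /base; lia.
have [xj xe] := (supported_partP _ _).1 xk.
apply: layP => // [j lj|].
  by have [->|/xj->] := eqVneq j k.+1.
by apply: xe; move: lk; rewrite /layer; lia.
Qed.

Lemma lay_inj k r s : layer n k -> lay k r = lay k s -> r = s.
Proof.
move=> lk /(congr1 (fun x : M => part x.2 k)).
by rewrite !part_lay lk eqxx.
Qed.

Lemma lay_mul i j r s : layer n i -> layer n j -> layer n (i + j) ->
  lay i r * lay j s = structure_const i j *: lay (i + j) (r * s).
Proof.
move=> li lj lij; rewrite -layZ; apply: layP => [|k lk|e].
- exact: mulr0.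
- change (part (0 *: (lay j s).2 + 0 *: (lay i r).2 +
    lmul (lay i r).2 (lay j s).2) k = if k == (i + j)%N then
    structure_const i j *: (r * s) else 0).
  have xi : supported (@slot_degree n S) i (lay i r).2.
    by move=> c ci; exact: (homog_lay r li (c := Some c)).
  rewrite !scale0r !add0r (part_mul_supp _ _ xi) lk /= !part_lay li eqxx /=.
  have [->|kij] := eqVneq k (i + j)%N.
    by rewrite leq_addr addKn lj eqxx.
  case: ifP => // ik; rewrite ifF ?mulr0 ?scaler0 //.
  by apply/negbTE; move: kij ik; lia.
- change (0 *: (lay j s).2 (inr e) + 0 *: (lay i r).2 (inr e) + 0 = 0 :> rat^o).
  by rewrite !scale0r !addr0.
Qed.

Lemma diff_lay k r : layer n k -> odd k -> layer n k.+1 ->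
  cdga_diff (lay k r) = lay k.+1 r.
Proof.
move=> lk ok lk1; apply: layP => // [j lj|e] /=.
  rewrite part_diff lj /= part_lay; have [->|jk] := eqVneq j k.+1.
    by rewrite /= negbK ok lk eqxx.
  case: ifP => // oj; rewrite ifF //; apply/negbTE; apply: contra jk => /andP[_].
  by move: lj; rewrite /layer /base; lia.
rewrite part_lay; case: (p =P k) ok => [<-|_ _]; first by rewrite /base odd_double.
by rewrite andbF incidence0.
Qed.

Lemma layer_base : layer n p. Proof. by rewrite /layer /base; lia. Qed.

Lemma diff_lay_base r : cdga_diff (lay p r) = edge_elt (incidence r).
Proof.
apply: unitizationP => //; apply: partP => [j lj|e].
  have -> : part (edge_elt (incidence r)).2 j = 0 by rewrite part_of_parts if_same.
  rewrite part_diff part_lay lj /=; case: ifP => // oj.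
  rewrite ifF //; apply/negbTE; move: lj; rewrite /layer /base; lia.
by change (incidence (part (lay p r).2 p) e = incidence r e);
   rewrite part_lay layer_base eqxx.
Qed.

Lemma edge_elt_inj h h' : edge_elt h = edge_elt h' -> h = h'.
Proof.
move=> /(congr1 (fun x : M => x.2)) hh; apply: funext => e.
exact: (congr1 (@^~ (inr e)) hh).
Qed.

Lemma model_decomp (x : M) :
  x = x.1 *: 1 + \sum_(k < 3 * p) lay k (part x.2 k) + edge_elt (x.2 \o inr).
Proof.
have s1 m (F : nat -> M) : (\sum_(k < m) F k).1 = \sum_(k < m) (F k).1.
  exact: (big_morph (fun x : M => x.1)).
have s2 m (F : nat -> M) : (\sum_(k < m) F k).2 = \sum_(k < m) (F k).2.
  exact: (big_morph (fun x : M => x.2)).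
apply: unitizationP.
  change (x.1 = x.1 * 1 + (\sum_(k < 3 * p) lay k (part x.2 k)).1 + 0).
  rewrite (s1 _ (fun k => lay k (part x.2 k))) big1 ?mulr1 ?addr0 //.
change (x.2 = x.1 *: (0 : slot n S -> rat^o) +
  (\sum_(k < 3 * p) lay k (part x.2 k)).2 + (edge_elt (x.2 \o inr)).2).
rewrite scaler0 add0r (s2 _ (fun k => lay k (part x.2 k))).
apply: funext => -[[[k lk] b]|e]; rewrite !fctE fct_sumE.
  have kp : (k < 3 * p)%N by move: lk; rewrite /layer; lia.
  rewrite (bigD1 (Ordinal kp)) //= eqxx big1 ?addr0 => [|i].
    by rewrite -(part_val x.2 (exist (layer n) k lk)).
  by rewrite -val_eqE /= eq_sym => /negbTE->.
by rewrite big1 ?add0r.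
Qed.

Section Automorphism.
Variables f g : {cdga M -> M}.
Hypotheses (fK : cancel f g) (gK : cancel g f).

Definition act (h : {cdga M -> M}) k (r : R) : R := part (h (lay k r)).2 k.

Lemma lay_act (h : {cdga M -> M}) k r :
  layer n k -> h (lay k r) = lay k (act h k r).
Proof.
by move=> lk; apply: homog_layE => //; apply/cdga_mor_homog/homog_lay.
Qed.

Lemma actK (h h' : {cdga M -> M}) k : layer n k -> cancel h h' ->
  cancel (act h k) (act h' k).
Proof.
by move=> lk hK r; apply: (lay_inj lk); rewrite -!lay_act // hK.
Qed.

Lemma actZ k a r : layer n k -> act f k (a *: r) = a *: act f k r.
Proof.
move=> lk; apply: (lay_inj lk); rewrite layZ -!lay_act // layZ.
exact: cdga_morZ.
Qed.

Lemma act_mul i j r s : layer n i -> layer n j -> layer n (i + j) ->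
  structure_const i j != 0 -> act f i r * act f j s = act f (i + j) (r * s).
Proof.
move=> li lj lij e0; apply: (lay_inj lij); apply: (scalerI e0).
rewrite -lay_mul // -!lay_act // -rmorphM lay_mul //.
exact: cdga_morZ.
Qed.

Lemma act_diff k : layer n k -> odd k -> layer n k.+1 -> act f k =1 act f k.+1.
Proof.
move=> lk ok lk1 r; apply: (lay_inj lk1).
by rewrite -diff_lay // -!lay_act // -cdga_mor_diff diff_lay.
Qed.

(** Factors that agree on both sides can be cancelled: a value 1 is reached,
    because the action on a layer is surjective. *)
Lemma act_shift i k j l : (i + k = j + l)%N -> layer n i -> layer n k ->
  layer n j -> layer n l -> layer n (i + k) ->
  structure_const i k != 0 -> structure_const j l != 0 ->
  act f k =1 act f l -> act f i =1 act f j.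
Proof.
move=> ijkl li lk lj ll lik ck cl akl r.
have := act_mul r (act g k 1) li lk lik ck.
rewrite ijkl -act_mul -?ijkl // -akl (actK lk gK).
by rewrite !mulr1.
Qed.

Lemma structure_const_even i j :
  ~~ odd i || ~~ odd j -> structure_const i j != 0.
Proof. by rewrite /structure_const -negb_and => /negbTE->. Qed.

Lemma structure_const_odd i j : (i < j)%N -> structure_const i j != 0.
Proof.
move=> ij; rewrite /structure_const; case: ifP => // _.
by rewrite subr_eq0 eqr_nat neq_ltn ij orbT.
Qed.

Ltac lay_lia := rewrite /layer /base; lia.

(** The step that breaks all rescalings.  The odd layers p + 3 and p + 5 act like
    p + 4 and p + 6, but their product lands in degree 2p + 8, like the product
    of the layers p + 2 and p + 6. *)
Lemma act_base2 : act f p.+2 =1 act f p.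
Proof.
have a34 : act f (p + 3) =1 act f (p + 4).
  by move=> r; rewrite act_diff -?addnS //; lay_lia.
have a56 : act f (p + 5) =1 act f (p + 6).
  by move=> r; rewrite act_diff -?addnS //; lay_lia.
have a32 : act f (p + 3) =1 act f (p + 2).
  apply: (@act_shift _ (p + 5) _ (p + 6)) => //; try lay_lia.
    by apply: structure_const_odd; lia.
  by apply: structure_const_even; lay_lia.
move=> r; rewrite -addn2; apply/esym; move: r.
apply: (@act_shift _ (p + 4) _ (p + 2)) => //; try lay_lia.
- by apply: structure_const_even; lay_lia.
- by apply: structure_const_even; lay_lia.
- by move=> r; rewrite -a34.
Qed.

(** With the first two even layers identified, multiplying by them moves along
    the even layers of degree less than 2p. *)
Lemma act_even m : (m.*2.+2 <= p)%N -> act f (p + m.*2) =1 act f p.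
Proof.
elim: m => [|m IH] mp r; first by rewrite addn0.
rewrite -IH; last by move: mp; lia.
move: r; apply: (@act_shift _ p _ p.+2) => //; try (move: mp; lay_lia).
- by apply: structure_const_even; lay_lia.
- by apply: structure_const_even; lay_lia.
- by move=> r; rewrite act_base2.
Qed.

(** This layer links the generating layers to degree 2p, the degree of products
    of two elements of layer p, by the differential. *)
Lemma act_last_odd : act f (2 * p).-1 =1 act f p.
Proof.
have e3 : act f (2 * p - 3) =1 act f p.
  move=> r; rewrite act_diff; try lay_lia.
  rewrite -(@act_even (n + 4)); last by lay_lia.
  by congr (act f _ r); rewrite /base; lia.
move=> r; rewrite -e3; move: r.
apply: (@act_shift _ p _ p.+2); try lay_lia.
- by apply: structure_const_even; lay_lia.
- by apply: structure_const_even; lay_lia.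
- by move=> r; rewrite act_base2.
Qed.

Lemma act_base_mul : {morph act f p : r s / r * s}.
Proof.
move=> r s; rewrite act_mul; try lay_lia.
  have -> : (p + p = (2 * p).-1.+1)%N by rewrite /base; lia.
  by rewrite -act_diff ?act_last_odd //; lay_lia.
by apply: structure_const_even; lay_lia.
Qed.

Lemma act_base1 : act f p 1 = 1.
Proof.
have := act_base_mul 1 (act g p 1).
by rewrite mul1r (actK layer_base gK) mulr1 => /esym.
Qed.

(** A layer of degree at least 2p is a product with layer p, except degree
    2p + 1, whose complementary degree p + 1 is not a layer; that one is linked
    to the next by the differential. *)
Lemma act_eq k : layer n k -> act f k =1 act f p.
Proof.
have low j : layer n j -> (j < 2 * p)%N -> act f j =1 act f p.
  move=> lj jp r; have [oj|ej] := boolP (odd j).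
    have [->|jl] := eqVneq j (2 * p).-1; first exact: act_last_odd.
    rewrite act_diff //; last by move: lj jp oj jl; lay_lia.
    rewrite -(@act_even (j.+1 - p)./2); last by move: lj jp oj jl; lay_lia.
    by congr (act f _ r); move: lj jp oj jl; lay_lia.
  rewrite -(@act_even (j - p)./2); last by move: lj jp ej; lay_lia.
  by congr (act f _ r); move: lj jp ej; lay_lia.
have high j : layer n j -> (2 * p <= j)%N -> j != (2 * p).+1 ->
    act f j =1 act f p.
  move=> lj pj jp r; have -> : j = (j - p + p)%N by move: pj; lay_lia.
  rewrite -{1}[r]mulr1 -act_mul; try (move: lj pj jp; lay_lia).
    by rewrite act_base1 mulr1 low //; move: lj pj jp; lay_lia.
  by apply: structure_const_even; lay_lia.
move=> lk r; have [kp|pk] := ltnP k (2 * p); first exact: low.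
have [k1|k1] := eqVneq k (2 * p).+1; last exact: high.
by rewrite act_diff ?high //; move: lk k1; lay_lia.
Qed.

Lemma act_comp : exists t : cell S -> cell S, forall x, act f p x = x \o t.
Proof.
apply: (@fun_alg_aut _ _ (act g p)).
- exact: actK layer_base fK.
- exact: actK layer_base gK.
- by move=> a x; apply: actZ layer_base.
- exact: act_base_mul.
Qed.

End Automorphism.

End Rigidity.

Lemma pull_lay n (S T : ternary) (u : tern_hom S T) k (r : cell T -> rat^o) :
  pull u (lay n k r) = lay n k (r \o cell_map u).
Proof.
apply: layP => // j lj.
change (part ((lay n k r).2 \o slot_map u) j =
  if j == k then r \o cell_map u else 0).
by rewrite part_pull part_lay lj /=; case: ifP.
Qed.

Lemma pull_inj n S T (u v : tern_hom S T) :
  pull u = pull v :> (model n T -> model n S) -> sval u =1 sval v.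
Proof.
move=> uv z; have := congr1 (@^~ (lay n (base n) (indic (inl (sval v z))))) uv.
rewrite !pull_lay => /(lay_inj (layer_base n)) /(congr1 (@^~ (inl z))) /=.
rewrite indicE /indic; case: asboolP => [[]//|_ /eqP].
by rewrite eq_sym oner_eq0.
Qed.

Lemma endo_kernel n S (f : {cdga model n S -> model n S}) (x : cell S -> rat^o) :
  incidence x = 0 -> incidence (act f (base n) x) = 0.
Proof.
move=> x0; apply: (@edge_elt_inj n).
rewrite -diff_lay_base -lay_act ?layer_base // -cdga_mor_diff diff_lay_base x0.
have -> : edge_elt n 0 = 0 :> model n S.
  by apply: unitizationP => //; apply: funext => -[].
exact: rmorph0.
Qed.

(** The permutation of nodes and edges given by [act_comp] sends edges to edges
    by [kernel_map]; applied to the inverse as well, this makes it send nodes to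
    nodes. *)
Theorem model_aut n S (f g : {cdga model n S -> model n S}) :
  cancel f g -> cancel g f ->
  exists u v : tern_hom S S, [/\ cancel (sval u) (sval v),
    cancel (sval v) (sval u) & f = pull u :> (model n S -> model n S)].
Proof.
move=> fK gK; have [t ft] := act_comp fK gK; have [s gs] := act_comp gK fK.
have tsE (x : cell S -> rat^o) : (x \o t) \o s = x.
  by rewrite -ft -gs (actK (layer_base n) fK).
have stE (x : cell S -> rat^o) : (x \o s) \o t = x.
  by rewrite -gs -ft (actK (layer_base n) gK).
have tK : cancel s t.
  move=> b; have := congr1 (@^~ b) (tsE (indic b)).
  by rewrite /= indicE /indic; case: asboolP.
have sK : cancel t s.
  move=> b; have := congr1 (@^~ b) (stE (indic b)).
  by rewrite /= indicE /indic; case: asboolP.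
have tker (x : cell S -> rat^o) : incidence x = 0 -> incidence (x \o t) = 0.
  by rewrite -ft; apply: endo_kernel.
have sker (x : cell S -> rat^o) : incidence x = 0 -> incidence (x \o s) = 0.
  by rewrite -gs; apply: endo_kernel.
have te := kernel_map tker; have se := kernel_map sker.
have /choice[u tu] z : exists w, t (inl z) = inl w.
  case tz: (t (inl z)) => [w|e]; first by exists w.
  by have [e' [] ] := se e; rewrite -tz sK.
have /choice[v sv] z : exists w, s (inl z) = inl w.
  case sz: (s (inl z)) => [w|e]; first by exists w.
  by have [e' [] ] := te e; rewrite -sz tK.
have uh q : tern q -> tern (map3 u q).
  move=> qS; have [[q' q'S] [_ /=]] := te (exist _ q qS).
  rewrite !tu => -[[e1] [e2] [e3]]; rewrite /map3 e1 e2 e3.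
  by case: q' q'S {e1 e2 e3} => -[].
have vh q : tern q -> tern (map3 v q).
  move=> qS; have [[q' q'S] [_ /=]] := se (exist _ q qS).
  rewrite !sv => -[[e1] [e2] [e3]]; rewrite /map3 e1 e2 e3.
  by case: q' q'S {e1 e2 e3} => -[].
pose U : tern_hom S S := exist _ u uh; pose W : tern_hom S S := exist _ v vh.
exists U, W; split.
- by move=> z; have := sK (inl z); rewrite tu sv => -[].
- by move=> z; have := tK (inl z); rewrite sv tu => -[].
have tU : t = cell_map U.
  apply: funext => -[z|e] /=; first exact: tu.
  have [e' [-> [/=]]] := te e; rewrite !tu => -[e1] [e2] [e3].
  congr inr; case: e' e e1 e2 e3 => [[[a b] c] abc] [q qS] /= e1 e2 e3.
  by apply: eq_exist; rewrite /map3 /= e1 e2 e3.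
have f_lay k r : layer n k -> f (lay n k r) = pull U (lay n k r).
  by move=> lk; rewrite lay_act // (act_eq gK lk) ft pull_lay tU.
apply: funext => x; rewrite [x]model_decomp !rmorphD.
have f1 a : f (a *: 1) = pull U (a *: 1).
  by rewrite !cdga_morZ !rmorph1.
congr (_ + _ + _); first exact: f1.
  rewrite !rmorph_sum; apply: eq_bigr => k _.
  have [lk|nlk] := boolP (layer n k); first exact: f_lay.
  have -> : lay n k (part x.2 k) = 0.
    apply/esym/layP => // j lj.
    by rewrite part0; case: eqP => // _; rewrite part_out.
  by rewrite !rmorph0.
(* A function on edges is the incidence of its extension by 0 to the nodes. *)
pose y : cell S -> rat^o := fun b => if b is inr e then x.2 (inr e) else 0.
have -> : edge_elt n (x.2 \o inr) = cdga_diff (lay n (base n) y).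
  rewrite diff_lay_base; congr (edge_elt n _).
  by apply: funext => e; rewrite /incidence /= !mulr0 !addr0.
transitivity (cdga_diff (f (lay n (base n) y))); first exact: cdga_mor_diff.
rewrite f_lay ?layer_base //; exact/esym/pull_diff.
Qed.

(** * Graphs with labelled arrows *)

(** The least element that is moved can be moved neither up nor down. *)
Lemma well_order_rigid (L : eqType) (le : rel L) (u v : L -> L) :
  well_order le -> cancel u v -> cancel v u ->
  {homo u : x y / le x y} -> {homo v : x y / le x y} -> u =1 id.
Proof.
move=> wo uK vK uh vh l; apply/eqP; apply/contraT => ul.
have wch : wo_chain le predT by move=> A _; exact: wo.
have tot : total le by move=> x y; exact: (wo_chainW wch).
have anti : antisymmetric le by move=> x y; apply: (wo_chain_antisymmetric wch).
have [z [[uz zmin] _]] := wo [pred x | u x != x] (ex_intro _ l ul).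
have uzz : u z != z := uz.
have [zu|uz'] := orP (tot z (u z)).
- have vz : le (v z) z by rewrite -{2}[z]uK; apply: vh.
  have vzz : v z != z by apply: contra uzz => /eqP {1}<-; rewrite vK.
  have /zmin zv : v z \in [pred x | u x != x] by rewrite inE vK eq_sym.
  by move: vzz; rewrite (anti (v z) z) ?eqxx // vz.
have /zmin zu : u z \in [pred x | u x != x] by rewrite inE (can_eq uK).
by move: uzz; rewrite (anti (u z) z) ?eqxx // uz'.
Qed.

Lemma exists_rigid_order (L : Type) : exists le : rel L, reflexive le /\
  forall u v : L -> L, cancel u v -> cancel v u ->
    {homo u : x y / le x y} -> {homo v : x y / le x y} -> u =1 id.
Proof.
have [le wo] := well_ordering_principle {classic L}.
exists le; split=> [x|u v uK vK uh vh]; last first.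
  exact: (well_order_rigid wo uK vK uh vh).
have wch : wo_chain le predT by move=> A _; exact: wo.
exact: (wo_chain_reflexive wch).
Qed.

Section Labelled.
Variables (L : Type) (le : rel L).
Hypothesis le_refl : reflexive le.
Hypothesis le_rigid : forall u v : L -> L, cancel u v -> cancel v u ->
    {homo u : x y / le x y} -> {homo v : x y / le x y} -> u =1 id.

(** Since the order is reflexive, the labels are exactly the nodes z for which
    (z, z, z) is related, so an automorphism preserves them. *)
Definition labelled (X : Type) (E : X -> X -> L -> Prop) : ternary :=
  @Ternary (X + L) (fun t => match t with
    | (inl x, inl y, inr l) => E x y l
    | (inr s, inr t, inr t') => le s t /\ t' = t
    | _ => False
    end).

Definition on_vertices (X Y : Type) (a : X -> Y) (z : X + L) : Y + L :=
  match z with inl x => inl (a x) | inr l => inr l end.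

Definition graph_hom X Y (E : X -> X -> L -> Prop) (F : Y -> Y -> L -> Prop)
  (a : X -> Y) := forall x y l, E x y l -> F (a x) (a y) l.

Lemma on_vertices_hom X Y E F (a : X -> Y) : graph_hom E F a ->
  forall t, @tern (labelled E) t -> @tern (labelled F) (map3 (on_vertices a) t).
Proof. by move=> aEF [[[x|s] [y|t]] [z|l]] //=; apply: aEF. Qed.

Definition labelled_hom X Y E F (a : X -> Y) (aEF : graph_hom E F a) :
  tern_hom (labelled E) (labelled F) := exist _ _ (on_vertices_hom aEF).

Lemma labelled_aut X (E : X -> X -> L -> Prop)
    (u v : tern_hom (labelled E) (labelled E)) :
  cancel (sval u) (sval v) -> cancel (sval v) (sval u) ->
  exists2 a : X -> X, graph_hom E E a & sval u = on_vertices a.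
Proof.
case: u v => [u uh] [v vh] /= uK vK.
pose hom w := forall t, @tern (labelled E) t -> @tern (labelled E) (map3 w t).
have label w : hom w -> forall l, exists l', w (inr l) = inr l'.
  move=> wh l; have /wh /= : @tern (labelled E) (inr l, inr l, inr l) by [].
  by rewrite /map3 /=; case: (w (inr l)) => // l' _; exists l'.
have /choice[u' uE] := label u uh; have /choice[v' vE] := label v vh.
have mono w w' : hom w -> (forall l, w (inr l) = inr (w' l)) -> {homo w' : s t / le s t}.
  move=> wh wE s t st.
  have /wh : @tern (labelled E) (inr s, inr t, inr t) by [].
  by rewrite /map3 /= !wE => -[].
have u1 : u' =1 id.
  apply: (@le_rigid _ v').
  - by move=> l; have := uK (inr l); rewrite uE vE => -[].
  - by move=> l; have := vK (inr l); rewrite vE uE => -[].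
  - exact: (mono u u' uh uE).
  - exact: (mono v v' vh vE).
have /choice[a aE] x : exists y, u (inl x) = inl y.
  case ux: (u (inl x)) => [y|l]; first by exists y.
  by have := uK (inl x); rewrite ux vE.
exists a => [x y l Exyl|].
  have /uh : @tern (labelled E) (inl x, inl y, inr l) by [].
  by rewrite /map3 /= !aE uE u1.
by apply: funext => -[x|l] /=; rewrite ?aE ?uE ?u1.
Qed.
End Labelled.

(** * Realisation of a group and of a subgroup *)

Lemma group_isomorphic_sym (G H : groupType) :
  group_isomorphic G H -> group_isomorphic H G.
Proof.
move=> [f [g fK gK]].
have gM : {morph g : x y / (x * y)%g}.
  by move=> x y; rewrite -{1}[x]gK -{1}[y]gK -gmulfM fK.
pose gm := isMultiplicative.Build H G g gM.
by exists (HB.pack_for {multiplicative H -> G} g gm); exists f.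
Qed.

Section Realization.
Variables (L : Type) (le : rel L) (n : nat).
Hypothesis le_refl : reflexive le.
Hypothesis le_rigid : forall u v : L -> L, cancel u v -> cancel v u ->
    {homo u : x y / le x y} -> {homo v : x y / le x y} -> u =1 id.

(** Every endomorphism, and not just every automorphism, is asked to come from G:
    the two graphs below have this stronger property, and it is the easier one
    to check. *)
Record symmetric_graph (G : groupType) := SymmetricGraph {
  vertex : Type;
  arrow : vertex -> vertex -> L -> Prop;
  move_by : G -> vertex -> vertex;
  move_by1 : move_by 1%g =1 id;
  move_byM : forall g h, move_by (g * h)%g =1 move_by g \o move_by h;
  move_by_hom : forall g, graph_hom arrow arrow (move_by g);
  move_by_inj : forall g h, move_by g =1 move_by h -> g = h;
  move_by_full : forall a, graph_hom arrow arrow a -> exists g, a =1 move_by g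
}.

Definition graph_model G (K : symmetric_graph G) :=
  model n (labelled le (@arrow G K)).

Definition pull_arrows G G' (K : symmetric_graph G) (K' : symmetric_graph G') a
    (aP : graph_hom (@arrow G K) (@arrow G' K') a) :
    {cdga graph_model K' -> graph_model K} := pull (labelled_hom le aP).

Section OneGroup.
Variables (G : groupType) (K : symmetric_graph G).

Definition move_hom g := labelled_hom le (@move_by_hom G K g).

Notation M := (graph_model K).

Lemma move_hom_comp g h :
  (pull (move_hom g) : M -> M) \o pull (move_hom h) =
  pull (move_hom (h * g)%g) :> (M -> M).
Proof. by apply: pull_comp => -[x|l] //=; rewrite move_byM. Qed.

Lemma move_hom1 : pull (move_hom 1%g) = id :> (M -> M).
Proof. by apply: pull_id => -[x|l] //=; rewrite move_by1. Qed.

Lemma move_homK g : cancel (pull (move_hom g) : M -> M)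
  (pull (move_hom g^-1%g)).
Proof.
move=> x; have /(congr1 (@^~ x)) /= := move_hom_comp g^-1%g g.
by rewrite mulgV move_hom1.
Qed.

Fact move_aut_subproof g :
  (pull (move_hom g^-1%g) : M -> M) \in
    @is_cdga_aut M.
Proof.
rewrite inE; exists (pull (move_hom g^-1%g)), (pull (move_hom g)).
split=> //; last exact: move_homK.
by have := move_homK g^-1%g; rewrite invgK.
Qed.

(** The inverse compensates for the contravariance of [pull]. *)
Definition move_aut (g : G) : cdga_aut M :=
  exist (fun f : M -> M => f \in @is_cdga_aut M)
    _ (move_aut_subproof g).

Lemma move_autM : {morph move_aut : g h / (g * h)%g}.
Proof.
by move=> g h; apply: val_inj; rewrite /= invgM -move_hom_comp.
Qed.

Lemma move_aut_inj : injective move_aut.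
Proof.
move=> g h /(congr1 val) /= /pull_inj gh; apply: invg_inj.
by apply: (@move_by_inj G K) => x; have := gh (inl x) => -[].
Qed.

Lemma move_aut_surj f : exists g, move_aut g = f.
Proof.
case: f => f fP; have := fP; rewrite inE => -[a [b [fa ab ba]]].
have [u [v [uv vu au]]] := model_aut ab ba.
have [c ch uc] := labelled_aut le_refl le_rigid uv vu.
have [g cg] := move_by_full ch.
exists g^-1%g; apply: val_inj; rewrite /= fa au; apply: pull_ext.
by move=> z; rewrite uc invgK; case: z => //= x; rewrite cg.
Qed.

HB.instance Definition _ :=
  isMultiplicative.Build G (cdga_aut M) move_aut move_autM.

Lemma move_aut_bij : bijective move_aut.
Proof.
have /choice[h hK] := move_aut_surj.
by exists h => // g; apply: move_aut_inj; rewrite hK.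
Qed.

Lemma aut_graph_model : group_isomorphic (cdga_aut M) G.
Proof.
by apply: group_isomorphic_sym; exists move_aut; exact: move_aut_bij.
Qed.
End OneGroup.

Lemma aut_pull_arrows G1 G2 (K1 : symmetric_graph G1) (K2 : symmetric_graph G2)
    a (aP : graph_hom (@arrow _ K2) (@arrow _ K1) a)
    (H : set (G1 * G2)) (Hgrp : group_closed [in H]) :
  (forall g1 g2, H (g1, g2) <-> a \o move_by g2 =1 move_by g1 \o a) ->
  group_isomorphic (cdga_aut_mor (pull_arrows aP)) (subgroup_of Hgrp).
Proof.
move=> HE; pose phi := pull_arrows aP.
have memE g1 g2 : ((move_aut K1 g1, move_aut K2 g2) \in aut_mor_set phi) =
    ((g1, g2) \in H).
  have -> : ((g1, g2) \in H) = ((g1^-1, g2^-1)%g \in H).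
    apply/idP/idP => /(group_closedV Hgrp) //.
    by have -> : ((g1^-1, g2^-1)^-1 = (g1, g2) :> G1 * G2)%g
      by congr pair; exact: invgK.
  suff mE : aut_mor_set phi (move_aut K1 g1, move_aut K2 g2) <->
      H (g1^-1, g2^-1)%g by apply/idP/idP; rewrite !inE => /mE.
  apply: (iff_trans _ (iff_sym (HE _ _))).
  have lhom : graph_hom (@arrow _ K2) (@arrow _ K1) (a \o move_by g2^-1%g).
    by move=> x y l xyl; apply/aP/move_by_hom.
  have rhom : graph_hom (@arrow _ K2) (@arrow _ K1) (move_by g1^-1%g \o a).
    by move=> x y l xyl; apply/move_by_hom/aP.
  rewrite /aut_mor_set /=.
  rewrite (@pull_comp _ _ _ _ _ _ (labelled_hom le lhom)); last by case.
  rewrite (@pull_comp _ _ _ _ _ _ (labelled_hom le rhom)); last by case.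
  split=> [/pull_inj lr x|lr]; first by have [] := lr (inl x).
  by apply: pull_ext => -[x|l] //=; congr inl; apply: lr.
have pairP (x : subgroup_of Hgrp) :
    (move_aut K1 (val x).1, move_aut K2 (val x).2) \in aut_mor_set phi.
  by rewrite memE -surjective_pairing; exact: (valP x).
pose F (x : subgroup_of Hgrp) : cdga_aut_mor phi :=
  exist (fun ab => ab \in aut_mor_set phi) _ (pairP x).
have FM : {morph F : x y / (x * y)%g}.
  by move=> x y; apply: val_inj; rewrite /= !move_autM.
pose Fm := isMultiplicative.Build _ _ F FM.
apply: group_isomorphic_sym.
exists (HB.pack_for {multiplicative subgroup_of Hgrp -> cdga_aut_mor phi} F Fm).
have Finj : injective F.
  move=> [[g1 g2] gH] [[h1 h2] hH] /(congr1 val) gh; apply: val_inj => /=.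
  congr pair; apply: move_aut_inj; first exact: (congr1 fst gh).
  exact: (congr1 snd gh).
have /choice[h hK] y : exists x, F x = y.
  case: y => -[f1 f2] fP; have [g1 g1E] := move_aut_surj f1.
  have [g2 g2E] := move_aut_surj f2.
  have gH : (g1, g2) \in H by rewrite -memE g1E g2E.
  exists (exist (fun g => g \in H) _ gH); apply: val_inj => /=.
  by rewrite -g1E -g2E.
by exists h => // x; apply: Finj; rewrite hK.
Qed.
End Realization.

(** * The two graphs *)

Section TwoGraphs.
Variables G1 G2 : groupType.

(** Taking all subsets of G1 * G2 instead of the cosets of H makes the graph
    independent of H. *)
Definition target_vertex := (G1 + set (G1 * G2))%type.
Definition label := (target_vertex + G2)%type.

Definition translate (g : G1) (Y : set (G1 * G2)) : set (G1 * G2) :=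
  [set q | Y ((g^-1)%g * q.1, q.2)%g].

(** The Cayley arrows make an endomorphism a translation on G1; the arrows named
    Y0 tie its effect on the subset Y0 to its effect on 1; the arrows with labels
    in G2 are all there, so they impose no condition on maps into the subsets. *)
Definition target_arrow (x y : target_vertex) (l : label) : Prop :=
  match x, y, l with
  | inl g, inl g', inl (inl s) => g' = (g * s)%g
  | inl g, inr Y, inl (inr Y0) => Y = translate g Y0
  | inr _, inr _, inr _ => True
  | _, _, _ => False
  end.

Definition target_move (g : G1) (x : target_vertex) : target_vertex :=
  match x with inl h => inl (g * h)%g | inr Y => inr (translate g Y) end.

Lemma translate1 Y : translate 1 Y = Y.
Proof. by apply/seteqP; split=> -[p q]; rewrite /translate /= invg1 mul1g. Qed.

Lemma translateM g h Y : translate (g * h) Y = translate g (translate h Y).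
Proof. by apply/seteqP; split=> -[p q]; rewrite /translate /= invgM mulgA. Qed.

Fact target_move1 : target_move 1%g =1 id.
Proof. by case=> [h|Y] /=; rewrite ?mul1g ?translate1. Qed.
Fact target_moveM g h : target_move (g * h)%g =1 target_move g \o target_move h.
Proof. by case=> [k|Y] /=; rewrite ?mulgA ?translateM. Qed.
Fact target_move_hom g : graph_hom target_arrow target_arrow (target_move g).
Proof.
move=> [x|X] [y|Y] [[s|Y0]|s] //= ->; first by rewrite mulgA.
by rewrite translateM.
Qed.
Fact target_move_inj g h : target_move g =1 target_move h -> g = h.
Proof. by move=> /(_ (inl 1%g)) /=; rewrite !mulg1 => -[]. Qed.
(** The image of 1 determines an endomorphism: the Cayley arrows carry it to the
    other elements of G1, and the arrows named Y carry it to Y. *)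
Fact target_move_full a : graph_hom target_arrow target_arrow a ->
  exists g, a =1 target_move g.
Proof.
move=> ah; case a1: (a (inl 1%g)) => [g|Y]; last first.
  have := ah (inl 1%g) (inl 1%g) (inl (inl 1%g)).
  by rewrite a1 /= mulg1 => /(_ erefl).
exists g => -[s|Y].
  have := ah (inl 1%g) (inl s) (inl (inl s)); rewrite a1 /= mul1g => /(_ erefl).
  by case: (a _) => // h ->.
have := ah (inl 1%g) (inr Y) (inl (inr Y)).
rewrite a1 /= translate1 => /(_ erefl).
by case: (a _) => // h ->.
Qed.

Definition target_graph : symmetric_graph label G1 := SymmetricGraph
  target_move1 target_moveM target_move_hom target_move_inj target_move_full.

Definition source_arrow (x y : G2) (l : label) : Prop :=
  if l is inr s then y = (x * s)%g else False.

Fact source_move1 : *%g (1%g : G2) =1 id. Proof. exact: mul1g. Qed.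
Fact source_moveM (g h : G2) : *%g (g * h)%g =1 *%g g \o *%g h.
Proof. by move=> x /=; rewrite mulgA. Qed.
Fact source_move_hom g : graph_hom source_arrow source_arrow ( *%g g).
Proof. by move=> x y [//|s] /= ->; rewrite mulgA. Qed.
Fact source_move_inj (g h : G2) : *%g g =1 *%g h -> g = h.
Proof. by move=> /(_ 1%g); rewrite !mulg1. Qed.
Fact source_move_full a : graph_hom source_arrow source_arrow a ->
  exists g, a =1 *%g g.
Proof.
move=> ah; exists (a 1%g) => s.
exact: (ah 1%g s (inr s) (esym (mul1g s))).
Qed.

Definition source_graph : symmetric_graph label G2 := SymmetricGraph
  source_move1 source_moveM source_move_hom source_move_inj source_move_full.

Variables (H : set (G1 * G2)) (Hgrp : group_closed [in H]).

(** This is the coset (1, g^-1) H. *)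
Definition coset_vertex (g : G2) : target_vertex :=
  inr [set q | H (q.1, (g * q.2)%g)].

Lemma coset_vertex_hom : graph_hom source_arrow target_arrow coset_vertex.
Proof. by move=> x y [|]. Qed.

(** From the right to the left, the two sides are compared at the vertex 1: the
    right-hand side contains (g1, 1) because H contains 1. *)
Lemma coset_vertex_equivariant g1 g2 : H (g1, g2) <->
  coset_vertex \o *%g g2 =1 target_move g1 \o coset_vertex.
Proof.
have HM x y : H x -> H y -> H (x * y)%g.
  by move=> Hx Hy; apply: set_mem; apply: (group_closedM Hgrp); rewrite inE.
have HV x : H x -> H (x^-1)%g.
  by move=> Hx; apply: set_mem; apply: (group_closedV Hgrp); rewrite inE.
have H1 : H 1%g by apply: set_mem; exact: Hgrp.1.
split=> [Hg g /=|/(_ 1%g)].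
  congr inr; apply/seteqP; split=> -[p q] /= Hpq.
    have := HM _ _ (HV _ Hg) Hpq.
    rewrite -[X in H X]/(g1^-1 * p, g2^-1 * (g2 * g * q))%g.
    by rewrite -mulgA mulKg.
  have := HM _ _ Hg Hpq.
  by rewrite -[X in H X]/(g1 * (g1^-1 * p), g2 * (g * q))%g mulVKg mulgA.
rewrite /= => -[] /(congr1 (@^~ (g1, 1%g))).
by rewrite /translate /= mulVg !mulg1 => ->.
Qed.
End TwoGraphs.

Theorem theorem1p3 (G1 G2 : groupType) (H : set (G1 * G2))
    (Hgrp : group_closed [in H]) (n : nat) (n_ge1 : (1 <= n)%N) :
  exists (M1 M2 : cdgaType) (phi : {cdga M1 -> M2}),
    [/\ n_connected n M1, n_connected n M2,
        group_isomorphic (cdga_aut_mor phi) (subgroup_of Hgrp),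
        group_isomorphic (cdga_aut M1) G1
      & group_isomorphic (cdga_aut M2) G2].
Proof.
have [le [le_refl le_rigid]] := exists_rigid_order (label G1 G2).
exists (graph_model le n (target_graph G1 G2)).
exists (graph_model le n (source_graph G1 G2)).
exists (pull_arrows le n (K := source_graph G1 G2) (K' := target_graph G1 G2)
  (coset_vertex_hom H)).
split; try exact: model_connected.
- apply: aut_pull_arrows => // g1 g2.
  exact: coset_vertex_equivariant.
- exact: aut_graph_model.
- exact: aut_graph_model.
Qed.
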